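(* Let $A\in M_{n\times n}(\mathbb{T})$ be an $n\times n$ matrix over the extended tropical semiring $\mathbb{T}$. Then the following are equivalent: (i) $A$ has tropical rank $n$, i.e. $\operatorname{rk}(A)=n$; (ii) $A$ is tropically nonsingular; (iii) $A$ is pseudo invertible.
   Context: Extended tropical semiring. Let $\mathbb{T}=\mathbb{R}\cup\mathbb{R}^\nu\cup\{-\infty\}$, where $\mathbb{R}^\nu=\{a^\nu: a\in\mathbb{R}\}$ is a disjoint copy of $\mathbb{R}$ (the ghosts). Put $\bar{\mathbb{R}}=\mathbb{R}\cup\{-\infty\}$ and $\bar{\mathbb{U}}=\mathbb{R}^\nu\cup\{-\infty\}$. Extend $\nu$ to $\mathbb{T}$ by $(a^\nu)^\nu=a^\nu$, $(-\infty)^\nu=-\infty$. Total order $\prec$ on $\mathbb{T}$: $-\infty$ is the least element; for reals $a<b$: $a\prec b$, $a\prec b^\nu$, $a^\nu\prec b$, $a^\nu\prec b^\nu$; and $a\prec a^\nu$ for every $a\in\mathbb{R}$. Addition: $x\oplus y=\max_{\prec}\{x,y\}$ if $x\neq y$, $x\oplus x=x^\nu$ (so $(-\infty)\oplus(-\infty)=-\infty$). Multiplication: $a\odot b=a+b$, $a^\nu\odot b=a\odot b^\nu=a^\nu\odot b^\nu=(a+b)^\nu$ for $a,b\in\mathbb{R}$, and $(-\infty)\odot x=x\odot(-\infty)=-\infty$. This is a commutative semiring with zero $-\infty$ and unit $0$. Matrix multiplication over $\mathbb{T}$ is defined by the usual formulas using $\oplus,\odot$. Dependence and rank. Vectors $v_1,\dots,v_m\in\mathbb{T}^{(n)}$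 (a family) are tropically dependent if there are $\alpha_1,\dots,\alpha_m\in\bar{\mathbb{R}}$, not all $-\infty$, with $\alpha_1v_1\oplus\cdots\oplus\alpha_mv_m\in\bar{\mathbb{U}}^{(n)}$; otherwise tropically independent. The tropical rank $\operatorname{rk}(A)$ of a matrix is the maximal number of tropically independent rows of $A$ (it may be $0$). Singularity. For $A=(a_{i,j})\in M_{n\times n}(\mathbb{T})$ the tropical determinant is $|A|=\bigoplus_{\sigma\in S_n}a_{1,\sigma(1)}\cdots a_{n,\sigma(n)}$ (products in $\odot$). $A$ is tropically singular if $|A|\in\bar{\mathbb{U}}$, and tropically nonsingular (regular) otherwise. Pseudo invertibility. A pseudo unit matrix is a tropically nonsingular matrix in $M_{n\times n}(\mathbb{T})$ with all diagonal entries equal to $0$ and all off-diagonal entries in $\bar{\mathbb{U}}$. $A$ is pseudo invertible if there is $B\in M_{n\times n}(\mathbb{T})$ such that both $AB$ and $BA$ are pseudo unit matrices. *)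

(* Defs.v *)
From HB Require Import structures.
From mathcomp Require Import all_boot all_order all_fingroup all_algebra.
From mathcomp Require Import boolp reals.
From mathcomp Require Import lra.
Set Implicit Arguments.
Unset Strict Implicit.
Unset Printing Implicit Defensive.
Import Order.TTheory GRing.Theory Num.Theory.
Local Open Scope ring_scope.

(* [Tangible a] is the real a, [Ghost a] is its ghost copy a^nu, and [NegInf]
   is -oo.  In the semiring structure defined below, [0] denotes [NegInf] and
   [1] denotes [Tangible 0]. *)
Inductive trop (R : Type) : Type :=
  | NegInf
  | Tangible of R
  | Ghost of R.

Arguments NegInf {R}.

Definition trop_encode (R : Type) (x : trop R) : option (R + R) :=
  match x with
  | NegInf => None
  | Tangible a => Some (inl a)
  | Ghost a => Some (inr a)
  end.

Definition trop_decode (R : Type) (s : option (R + R)) : trop R :=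
  match s with
  | None => NegInf
  | Some (inl a) => Tangible a
  | Some (inr a) => Ghost a
  end.

Lemma trop_encodeK (R : Type) : cancel (@trop_encode R) (@trop_decode R).
Proof. by case. Qed.

HB.instance Definition _ (R : choiceType) :=
  Choice.copy (trop R) (can_type (@trop_encodeK R)).

Lemma trop_eqE (R : choiceType) (x y : trop R) :
  (x == y) = match x, y with
             | NegInf, NegInf => true
             | Tangible a, Tangible b => a == b
             | Ghost a, Ghost b => a == b
             | _, _ => false
             end.
Proof.
case: x y => [|a|a] [|b|b]; apply/idP/idP => // /eqP // => [[->]|->|[->]|->];
  exact: eqxx.
Qed.

Section TropicalOrder.
Variable R : realDomainType.
Implicit Types x y z : trop R.

Definition trop_lt x y : bool :=
  match x, y with
  | _, NegInf => false
  | NegInf, _ => true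
  | Tangible a, Tangible b => a < b
  | Tangible a, Ghost b => a <= b
  | Ghost a, Tangible b => a < b
  | Ghost a, Ghost b => a < b
  end.

Definition trop_le x y : bool := (x == y) || trop_lt x y.

Fact trop_lt_irr : irreflexive trop_lt.
Proof. by case=> [|a|a] //=; rewrite ltxx. Qed.

Fact trop_lt_trans : transitive trop_lt.
Proof. by case=> [|b|b] [|a|a] [|c|c] //=; lra. Qed.

Fact trop_lt_total x y : x != y -> trop_lt x y || trop_lt y x.
Proof.
by case: x y => [|a|a] [|b|b] //; rewrite trop_eqE /=; case: (ltgtP a b).
Qed.

End TropicalOrder.

Fact trop_display : Order.disp_t. Proof. exact: Order.Disp tt tt. Qed.

HB.instance Definition _ (R : realDomainType) :=
  @Order.LtOrder.Build trop_display (trop R) (@trop_le R) (@trop_lt R) _ _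
    (fun _ _ => erefl) (fun _ _ => erefl) (fun _ _ => erefl)
    (@trop_lt_irr R) (@trop_lt_trans R) (@trop_lt_total R).

Section TropicalSemiring.
Variable R : realDomainType.
Implicit Types x y z : trop R.

Definition nu x : trop R :=
  match x with
  | NegInf => NegInf
  | Tangible a => Ghost a
  | Ghost a => Ghost a
  end.

Definition trop_add x y : trop R := if x == y then nu x else Order.max x y.

Definition trop_mul x y : trop R :=
  match x, y with
  | NegInf, _ | _, NegInf => NegInf
  | Tangible a, Tangible b => Tangible (a + b)
  | Tangible a, Ghost b | Ghost a, Tangible b | Ghost a, Ghost b => Ghost (a + b)
  end.

Lemma trop_addE x y : trop_add x y =
  match x, y with
  | NegInf, _ => y
  | _, NegInf => x
  | Tangible a, Tangible b => if a == b then Ghost a else if a < b then y else x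
  | Tangible a, Ghost b => if a <= b then y else x
  | Ghost a, Tangible b => if a < b then y else x
  | Ghost a, Ghost b => if a < b then y else x
  end.
Proof.
rewrite /trop_add /Order.max trop_eqE -[(x < y)%O]/(trop_lt x y).
by case: x y => [|a|a] [|b|b] //=; case: (ltgtP a b) => // ->.
Qed.

Fact trop_addA : associative trop_add.
Proof.
case=> [|a|a] [|b|b] [|c|c]; rewrite !trop_addE //;
  repeat (match goal with |- context [if ?t then _ else _] =>
            let h := fresh in case: (boolP t) => h; rewrite ?trop_addE end => //);
  by [ | congr Tangible; lra | congr Ghost; lra | exfalso; lra].
Qed.

Fact trop_addC : commutative trop_add.
Proof.
by case=> [|a|a] [|b|b]; rewrite !trop_addE //; case: (ltgtP a b) => // ->.
Qed.

Fact trop_add0 : left_id NegInf trop_add.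
Proof. by move=> x; rewrite trop_addE. Qed.

Fact trop_mulA : associative trop_mul.
Proof. by case=> [|a|a] [|b|b] [|c|c] //=; rewrite addrA. Qed.

Fact trop_mulC : commutative trop_mul.
Proof. by case=> [|a|a] [|b|b] //=; rewrite addrC. Qed.

Fact trop_mul1 : left_id (Tangible 0) trop_mul.
Proof. by case=> [|a|a] //=; rewrite add0r. Qed.

Fact trop_mulDl : left_distributive trop_mul trop_add.
Proof.
case=> [|a|a] [|b|b] [|c|c]; rewrite !trop_addE //=;
  repeat (match goal with |- context [if ?t then _ else _] =>
            let h := fresh in case: (boolP t) => h end => //=);
  by [ | congr Tangible; lra | congr Ghost; lra | exfalso; lra].
Qed.

Fact trop_mul0 : left_zero NegInf trop_mul.
Proof. by []. Qed.

Fact trop_1_neq0 : Tangible 0 != NegInf :> trop R.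
Proof. by rewrite trop_eqE. Qed.

HB.instance Definition _ :=
  GRing.isNmodule.Build (trop R) trop_addA trop_addC trop_add0.

HB.instance Definition _ :=
  GRing.Nmodule_isComNzSemiRing.Build (trop R)
    trop_mulA trop_mulC trop_mul1 trop_mulDl trop_mul0 trop_1_neq0.

Definition in_Rbar x : bool := if x is Ghost _ then false else true.
Definition in_Ubar x : bool := if x is Tangible _ then false else true.

Definition trop_dependent (n : nat) (I : finType) (v : I -> 'rV[trop R]_n) :
    Prop :=
  exists alpha : I -> trop R,
    [/\ forall i, in_Rbar (alpha i),
        exists i, alpha i != NegInf &
        forall j : 'I_n, in_Ubar ((\sum_i alpha i *: v i) 0 j)].

Definition trop_independent (n : nat) (I : finType) (v : I -> 'rV[trop R]_n) :
    Prop :=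
  ~ trop_dependent v.

(* Sets of rows are taken as sets of row indices; equal rows at distinct
   indices are dependent, so repetitions cannot increase the rank. *)
Definition trop_rank (m n : nat) (A : 'M[trop R]_(m, n)) : nat :=
  \max_(S : {set 'I_m} |
        `[< trop_independent (fun i : {i : 'I_m | i \in S} => row (val i) A) >])
    #|S|.

(* There are no signs: this is the permanent over [trop R]. *)
Definition trop_det (n : nat) (A : 'M[trop R]_n) : trop R :=
  \sum_(s : 'S_n) \prod_(i < n) A i (s i).

Definition trop_singular (n : nat) (A : 'M[trop R]_n) : Prop :=
  in_Ubar (trop_det A).

Definition trop_nonsingular (n : nat) (A : 'M[trop R]_n) : Prop :=
  ~ trop_singular A.

Definition pseudo_unit (n : nat) (A : 'M[trop R]_n) : Prop :=
  [/\ trop_nonsingular A,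
      forall i, A i i = Tangible 0 &
      forall i j, i != j -> in_Ubar (A i j)].

Definition pseudo_invertible (n : nat) (A : 'M[trop R]_n) : Prop :=
  exists B : 'M[trop R]_n, pseudo_unit (A *m B) /\ pseudo_unit (B *m A).

End TropicalSemiring.

(* Main.v *)
(* Write [|x|] for the magnitude of [x].  A sum is ghost or -oo iff each of its
   tangible terms is dominated in magnitude by another term.

   Singular matrices have dependent rows.  If the determinant is not -oo,
   expand along a column in which an optimal permutation has a ghost entry or
   two optimal permutations differ: the tangible parts of the minors are the
   coefficients of a dependence.  If it is -oo, drop rows until the remaining
   [m + 1] rows admit a transversal of [m] of them but not of all, restrict to
   the [m] columns it uses, add a column of ghosts and apply the first case.

   A nonsingular matrix has a unique optimal permutation, so after permuting
   the columns it is a weighted digraph whose nontrivial cycles are negative.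
   Potentials (largest weights of simple paths) rescale it so that the diagonal
   is 0 and all other magnitudes are at most [- d] for some [d > 0].  Then the
   matrix with diagonal 0 and [Ghost (- d)] elsewhere is a pseudo inverse, and a
   dependence of the rows is impossible.

   Finally, if [A B] is nonsingular then so is [A]: a dependence of the rows of
   [A] is one of the rows of [A B]. *)

Require Import Defs.
From mathcomp Require Import all_boot all_order all_algebra.
From mathcomp Require Import reals.
From mathcomp Require Import all_fingroup boolp lra.
Set Implicit Arguments.
Unset Strict Implicit.
Unset Printing Implicit Defensive.
Import Order.TTheory GRing.Theory Num.Theory.
Local Open Scope ring_scope.

(** * Magnitudes, and when a sum is ghost or -oo *)

Section Magnitude.
Variable R : realDomainType.
Implicit Types x y z : trop R.

(* Junk value [mag NegInf = 0]. *)
Definition mag x : R :=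
  match x with NegInf => 0 | Tangible a | Ghost a => a end.

(** Makes an element usable as a coefficient of a dependence, which must satisfy [in_Rbar], at the
    same magnitude. *)
Definition tangible_part x : trop R :=
  if x is Ghost a then Tangible a else x.

Lemma trop_plusE x y : x + y = trop_add x y. Proof. by []. Qed.

Lemma trop_multE x y : x * y = trop_mul x y. Proof. by []. Qed.

Lemma trop_mul_eq0 x y : (x * y == 0) = (x == 0) || (y == 0).
Proof. by case: x y => [|a|a] [|b|b]; rewrite !trop_eqE. Qed.

(** Magnitudes are compared through [nu], for which [NegInf] is least; this brings such comparisons
    down to linear arithmetic. *)
Lemma nu_leE x y :
  (nu x <= nu y)%O = (x == 0) || (y != 0) && (mag x <= mag y).
Proof.
rewrite -[(_ <= _)%O]/(trop_le _ _) /trop_le.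
by case: x y => [|a|a] [|b|b] //; rewrite !trop_eqE //= ?le_eqVlt.
Qed.

Lemma nuM x y : nu (x * y) = nu x * nu y.
Proof. by case: x y => [|a|a] [|b|b]. Qed.

Lemma nu_tangible_part x : nu (tangible_part x) = nu x.
Proof. by case: x. Qed.

Lemma nu_eq0 x : (nu x == 0) = (x == 0).
Proof. by case: x => [|a|a]; rewrite !trop_eqE. Qed.

Lemma nu_leM x x' y y' :
  (nu x <= nu x')%O -> (nu y <= nu y')%O -> (nu (x * y) <= nu (x' * y'))%O.
Proof.
rewrite !nu_leE.
case: x x' y y' => [|a|a] [|b|b] [|c|c] [|d|d]; rewrite !trop_eqE //=; lra.
Qed.

Lemma nu_addl x y : (nu x <= nu (x + y))%O.
Proof.
rewrite nu_leE trop_plusE trop_addE.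
case: x y => [|a|a] [|b|b]; rewrite ?trop_eqE //=;
  repeat case: ifP => ?; rewrite ?trop_eqE //=; lra.
Qed.

Lemma trop_add_absorb x y : (nu y < nu x)%O -> y + x = x.
Proof.
rewrite ltNge nu_leE trop_plusE trop_addE.
case: x y => [|a|a] [|b|b]; rewrite ?trop_eqE //= -?ltNge => h;
  by repeat case: ifP => ? //; exfalso; lra.
Qed.

Lemma trop_add_cases x y : [\/ in_Ubar (x + y), x + y = x | x + y = y].
Proof.
rewrite trop_plusE trop_addE.
by case: x y => [|a|a] [|b|b]; repeat case: ifP => _;
  try (by apply: Or31); try (by apply: Or32); apply: Or33.
Qed.

Lemma nu_add_cases x y : nu (x + y) = nu x \/ nu (x + y) = nu y.
Proof.
rewrite trop_plusE trop_addE.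
by case: x y => [|a|a] [|b|b]; repeat case: ifP => _;
  try (by left); right.
Qed.

Lemma in_UbarD x y : in_Ubar x -> in_Ubar y -> in_Ubar (x + y).
Proof.
by rewrite trop_plusE trop_addE; case: x y => [|a|a] [|b|b] //= _ _; case: ifP.
Qed.

Lemma in_UbarMr x y : in_Ubar x -> in_Ubar (x * y).
Proof. by case: x y => [|a|a] [|b|b]. Qed.

Lemma in_UbarMl x y : in_Ubar y -> in_Ubar (x * y).
Proof. by rewrite mulrC; apply: in_UbarMr. Qed.

Lemma in_Ubar_sum (I : finType) (x : I -> trop R) :
  (forall i, in_Ubar (x i)) -> in_Ubar (\sum_i x i).
Proof. by move=> h; elim/big_ind: _ => // y z; apply: in_UbarD. Qed.

Lemma nu_sum (I : finType) (P : pred I) (x : I -> trop R) i :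
  P i -> (nu (x i) <= nu (\sum_(j | P j) x j))%O.
Proof. by move=> Pi; rewrite (bigD1 i) //=; apply: nu_addl. Qed.

Lemma nu_sum_attained (I : finType) (P : pred I) (x : I -> trop R) i0 :
  P i0 -> exists2 i, P i & nu (x i) = nu (\sum_(j | P j) x j).
Proof.
move=> Pi0; have := nu_sum x Pi0; set s := \sum_(j | _) _.
have : s = 0 \/ exists2 i, P i & nu (x i) = nu s.
  rewrite {}/s; elim/big_rec: _ => [|i y Pi IH]; first by left.
  case: IH => [->|IH]; right; first by exists i; rewrite ?addr0.
  by case: (nu_add_cases (x i) y) => ->; first by exists i.
case=> [s0|//]; rewrite s0 nu_leE eqxx orbF => /eqP x0.
by exists i0; rewrite ?x0.
Qed.

Lemma prod_neq0 (I : finType) (x : I -> trop R) :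
  (\prod_i x i != 0) = [forall i, x i != 0].
Proof.
apply/idP/forallP => [h i|h].
  by apply: contraNneq h => xi; rewrite (bigD1 i) //= xi mul0r.
by elim/big_rec: _ => // i y _; rewrite trop_mul_eq0 negb_or h.
Qed.

Lemma prod_tangible (I : finType) (x : I -> trop R) :
  ~~ in_Ubar (\prod_i x i) = [forall i, ~~ in_Ubar (x i)].
Proof.
apply/idP/forallP => [h i|h].
  by apply: contra h => xi; rewrite (bigD1 i) //= in_UbarMr.
elim/big_rec: _ => // i y _; move: (h i).
by case: (x i) => // a _; case: y.
Qed.

Lemma mag_prod (I : finType) (x : I -> trop R) :
  (forall i, x i != 0) -> mag (\prod_i x i) = \sum_i mag (x i).
Proof.
move=> x0.
suff [] : \prod_i x i != 0 /\ mag (\prod_i x i) = \sum_i mag (x i) by [].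
elim/big_rec2: _ => // i a y _ [y0 <-]; rewrite trop_mul_eq0 negb_or x0 y0.
by move: (x0 i) y0; case: (x i) y => [|b|b] [|c|c].
Qed.

Lemma sum_absorb (I : finType) (x : I -> trop R) i :
  (forall j, j != i -> x j + x i = x i) -> \sum_j x j = x i.
Proof.
move=> h; rewrite (bigD1 i) //= addrC.
by elim/big_rec: _ => [|j y ji yE]; rewrite ?add0r // -addrA yE h.
Qed.

(** An undominated tangible term absorbs all others and is the sum. Conversely, a tangible sum
    equals one of its terms [x i], and a rest of magnitude at least that of [x i] would change
    it. *)
Lemma sum_tangibleP (I : finType) (x : I -> trop R) :
  in_Ubar (\sum_i x i) <->
  forall i, ~~ in_Ubar (x i) -> exists2 j, j != i & (nu (x i) <= nu (x j))%O.
Proof.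
split=> [sumU i xiT | h].
  case: (pickP (fun j => (j != i) && (nu (x i) <= nu (x j))%O)).
    by move=> j /andP[]; exists j.
  move=> hj.
  move: sumU; rewrite (@sum_absorb _ _ i) ?(negPf xiT) // => j ji.
  by apply: trop_add_absorb; rewrite ltNge; move: (hj j); rewrite ji /= => ->.
case: (boolP (in_Ubar _)) => // sT.
have [U|[i xiE]] : in_Ubar (\sum_i x i) \/ exists i, x i = \sum_i x i.
  elim/big_ind: _ => [||i _]; [by left| |by right; exists i].
  move=> y z; case: (trop_add_cases y z) => [U|yE|zE]; first by left.
    by rewrite yE.
  by rewrite zE.
  by rewrite U in sT.
have [j ji xij] : exists2 j, j != i & (nu (x i) <= nu (x j))%O.
  by apply: h; rewrite xiE.
have := le_trans xij (@nu_sum _ (predC1 i) x j ji).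
move: xiE sT {xij}; rewrite (bigD1 i) //=.
rewrite nu_leE trop_plusE trop_addE.
case: (x i) (\sum_(j | _) _) => [|a|a] [|b|b]; rewrite ?trop_eqE //=;
  repeat case: ifP => ?; move=> // xE *; try (case: xE => xE); (done || lra).
Qed.

End Magnitude.

(** * Singular matrices have dependent rows *)

Section SingularDependent.
Variable R : realDomainType.

Lemma rows_dependentE (m n : nat) (A : 'M[trop R]_(m, n)) :
  trop_dependent (fun i => row i A) <->
  exists alpha : 'I_m -> trop R,
    [/\ forall i, in_Rbar (alpha i), exists i, alpha i != 0 &
        forall j, in_Ubar (\sum_i alpha i * A i j)].
Proof.
have colE (alpha : 'I_m -> trop R) j :
    (\sum_i alpha i *: row i A) 0 j = \sum_i alpha i * A i j.
  by rewrite summxE; apply: eq_bigr => i _; rewrite !mxE.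
by split=> -[alpha [tA nzA colA]]; exists alpha; split=> // j;
  [rewrite -colE | rewrite colE].
Qed.

(** The permanent with row [i] and column [j0] deleted, taken over permutations of all indices to
    avoid reindexing. *)
Definition minor (n : nat) (A : 'M[trop R]_n) j0 i : trop R :=
  \sum_(s : 'S_n | s i == j0) \prod_(k | k != i) A k (s k).

Lemma minor_attained (n : nat) (A : 'M[trop R]_n) j0 i :
  exists2 s : 'S_n, s i = j0 &
    nu (minor A j0 i) = nu (\prod_(k | k != i) A k (s k)).
Proof.
have [|s /eqP si sE] := @nu_sum_attained _ _ (fun s : 'S_n => s i == j0)
    (fun s : 'S_n => \prod_(k | k != i) A k (s k)) (tperm i j0).
  by rewrite tpermL.
by exists s => //; exact: esym sE.
Qed.

Lemma nu_le_minor (n : nat) (A : 'M[trop R]_n) (s : 'S_n) i :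
  (nu (\prod_(k | k != i) A k (s k)) <= nu (minor A (s i) i))%O.
Proof.
exact: (@nu_sum _ _ (fun t : 'S_n => t i == s i)
  (fun t : 'S_n => \prod_(k | k != i) A k (t k))).
Qed.

(* Expanding along column [j] the determinant in which column [j0] is replaced
   by column [j], every term occurs twice: swap the rows using [j]. *)
Lemma minor_exchange (n : nat) (A : 'M[trop R]_n) j0 j i : j != j0 ->
  exists2 i', i' != i &
    (nu (minor A j0 i * A i j) <= nu (minor A j0 i' * A i' j))%O.
Proof.
move=> jj0; have [s si sE] := minor_attained A j0 i.
pose i' := (s^-1)%g j; have si' : s i' = j by rewrite /i' permKV.
have i'i : i' != i by apply: contraNneq jj0 => i'i; rewrite -si' i'i si.
exists i' => //; pose t := (tperm i i' * s)%g.
have ti' : t i' = j0 by rewrite /t permM tpermR.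
have ti : t i = j by rewrite /t permM tpermL.
apply: (@le_trans _ _ (nu ((\prod_(k | k != i') A k (t k)) * A i' j))).
  rewrite nuM sE -nuM (bigD1 i') //= si'.
  rewrite [X in (_ <= nu (X * _))%O](bigD1 i) 1?eq_sym //= ti.
  rewrite [X in (_ <= nu (_ * X * _))%O](_ : _ =
      \prod_(k | (k != i) && (k != i')) A k (s k)).
    by rewrite [X in (nu X <= _)%O]mulrC mulrCA [X in (nu X <= _)%O]mulrC.
  apply: eq_big => [k|k /andP[ki' ki]]; first by rewrite andbC.
  by rewrite /t permM tpermD 1?eq_sym.
by rewrite -ti'; apply: nu_leM => //; exact: nu_le_minor.
Qed.

Lemma nu_minor_le_det (n : nat) (A : 'M[trop R]_n) i j :
  (nu (minor A j i * A i j) <= nu (trop_det A))%O.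
Proof.
have [s si sE] := minor_attained A j i.
rewrite nuM sE -nuM -si mulrC -(bigD1 i (P := xpredT)) //=.
exact: (@nu_sum _ _ xpredT (fun s : 'S_n => \prod_k A k (s k))).
Qed.

Lemma nu_prod_le_minor (n : nat) (A : 'M[trop R]_n) (s : 'S_n) i :
  (nu (\prod_k A k (s k)) <= nu (minor A (s i) i * A i (s i)))%O.
Proof.
by rewrite (bigD1 i) //= mulrC; apply: nu_leM => //; apply: nu_le_minor.
Qed.

(** In a column other than [s i0], [minor_exchange] pairs the terms. In column [s i0] no term
    exceeds the determinant and that of row [i0] attains it, so only the latter could be
    undominated; the hypothesis makes it ghost or gives it a rival coming from [t]. *)
Lemma minor_dependent (n : nat) (A : 'M[trop R]_n) (s : 'S_n) i0 :
    let p (t : 'S_n) := \prod_k A k (t k) in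
    trop_det A != 0 -> nu (p s) = nu (trop_det A) ->
    in_Ubar (A i0 (s i0)) \/
      (exists2 t : 'S_n, t i0 != s i0 & nu (p t) = nu (trop_det A)) ->
  let alpha i := tangible_part (minor A (s i0) i) in
  alpha i0 != 0 /\ forall j, in_Ubar (\sum_i alpha i * A i j).
Proof.
move=> p det0 ps h alpha; split.
  apply: contraNneq det0 => a0; have := nu_prod_le_minor A s i0.
  rewrite nuM -[nu (minor _ _ _)]nu_tangible_part [tangible_part _]a0.
  rewrite -/(p s) ps -nuM mul0r.
  by rewrite nu_leE eqxx orbF.
have nuE i j : nu (alpha i * A i j) = nu (minor A (s i0) i * A i j).
  by rewrite !nuM nu_tangible_part.
move=> j; apply/sum_tangibleP => i aA.
case: (eqVneq j (s i0)) aA => [->|jj0] aA; last first.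
  have [i' i'i le] := minor_exchange A i jj0.
  by exists i' => //; rewrite !nuE.
have [ii0|ii0] := eqVneq i i0; last first.
  exists i0; first by rewrite eq_sym.
  rewrite !nuE; apply: le_trans (nu_minor_le_det A i (s i0)) _.
  by rewrite -ps; apply: nu_prod_le_minor.
case: h => [U|[t ti0 pt]].
  by move: aA; rewrite ii0 in_UbarMl.
pose i1 := (t^-1)%g (s i0); have ti1 : t i1 = s i0 by rewrite /i1 permKV.
exists i1.
  by rewrite ii0; apply: contraNneq ti0 => i10; rewrite -{1}i10 ti1.
rewrite !nuE; apply: le_trans (nu_minor_le_det A i (s i0)) _.
by rewrite -pt -ti1; apply: nu_prod_le_minor.
Qed.

Lemma singular_dependent_pos (n : nat) (A : 'M[trop R]_n) :
  trop_singular A -> trop_det A != 0 -> trop_dependent (fun i => row i A).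
Proof.
move=> sing det0; pose p (s : 'S_n) := \prod_k A k (s k).
have [s _ ps] := @nu_sum_attained _ _ xpredT p 1%g isT.
apply/rows_dependentE.
suff [i0 h] : exists i0, in_Ubar (A i0 (s i0)) \/
    (exists2 t : 'S_n, t i0 != s i0 & nu (p t) = nu (trop_det A)).
  have [a0 aA] := minor_dependent det0 ps h.
  exists (fun i => tangible_part (minor A (s i0) i)); split=> //.
    by move=> i; case: (minor A (s i0) i).
  by exists i0.
case: (boolP (in_Ubar (p s))) => [U|T].
  move: U; rewrite -[in_Ubar _]negbK prod_tangible negb_forall.
  by case/existsP=> i; rewrite negbK => Ui; exists i; left.
have [t ts le] := (sum_tangibleP p).1 sing s T.
have /existsP[i0 ti] : [exists i, t i != s i].
  apply: contraNT ts => /existsPn tsE; apply/eqP/permP => i.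
  by have /negPn/eqP := tsE i.
exists i0; right; exists t => //; apply/eqP; rewrite eq_le -{2}ps le andbT.
exact: (@nu_sum _ _ xpredT p).
Qed.

(** Induction on the rows: if those after the first have no transversal either, the first gets
    coefficient -oo. Otherwise [f] is a transversal of them, and the coefficients are the minors of
    [B] along its ghost column. *)
Lemma no_transversal_dependent (m n : nat) (A : 'M[trop R]_(m, n)) :
  (forall f : 'I_m -> 'I_n, injective f -> exists i, A i (f i) = 0) ->
  trop_dependent (fun i => row i A).
Proof.
elim: m A => [|m IH] A noT.
  have [|i0 _] := noT (fun i : 'I_0 =>
      match i with Ordinal _ h => False_rect _ (notF h) end).
    by case.
  by case: i0.
case: (pselect (exists2 f : 'I_m -> 'I_n, injective f &
    forall i, A (lift ord0 i) (f i) <> 0)) => [[f f_inj Af]|noF]; last first.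
  have /IH/rows_dependentE[alpha [tA [i0 nz] col]] : forall f : 'I_m -> 'I_n,
      injective f -> exists i, (row' ord0 A) i (f i) = 0.
    move=> f f_inj; apply: contrapT => h; apply: noF; exists f => // i Ai.
    by apply: h; exists i; rewrite mxE.
  apply/rows_dependentE.
  exists (fun i => if unlift ord0 i is Some k then alpha k else 0); split.
  - by move=> i; case: unlift.
  - by exists (lift ord0 i0); rewrite liftK.
  move=> j; rewrite big_ord_recl unlift_none mul0r add0r.
  rewrite (eq_bigr (fun i => alpha i * row' ord0 A i j)); first exact: col.
  by move=> i _; rewrite liftK mxE.
(* Every permutation meets the ghost column, so [minor_dependent] applies at the row where an
   optimal one does. The identity, which follows [f], shows that the determinant is not -oo. *)
pose B : 'M[trop R]_m.+1 :=
  \matrix_(i, j) if unlift ord0 j is Some k then A i (f k) else Ghost 0.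
have B0 i : B i ord0 = Ghost 0 by rewrite mxE unlift_none.
have BS i k : B i (lift ord0 k) = A i (f k) by rewrite mxE liftK.
pose p (s : 'S_m.+1) := \prod_k B k (s k).
have pU s : in_Ubar (p s).
  by rewrite /p (bigD1 ((s^-1)%g ord0)) //= permKV B0 in_UbarMr.
have det0 : trop_det B != 0.
  have p1 : p 1%g != 0.
    rewrite prod_neq0; apply/forallP => i; rewrite perm1.
    case: (unliftP ord0 i) => [k ->|->]; last by rewrite B0.
    by rewrite BS; apply/eqP.
  apply: contraNneq p1 => d0; have := @nu_sum _ _ xpredT p 1%g isT.
  by rewrite -/(trop_det B) d0 nu_leE eqxx orbF.
have [s _ ps] := @nu_sum_attained _ _ xpredT p 1%g isT.
pose i0 := (s^-1)%g ord0; have si0 : s i0 = ord0 by rewrite /i0 permKV.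
have := @minor_dependent _ B s i0 det0 ps.
rewrite si0 B0 => -[|nz col]; first by left.
apply/rows_dependentE.
exists (fun i => tangible_part (minor B ord0 i)); split.
- by move=> i; case: (minor B ord0 i).
- by exists i0.
move=> j; case: (pickP (fun k => f k == j)) => [k /eqP <-|fj].
  by have := col (lift ord0 k); under eq_bigr => i _ do rewrite BS.
(* In a column outside the range of [f], a term other than -oo would extend a transversal attaining
   [minor B ord0 i] by the entry at [i], [j] to a full transversal [g]. *)
rewrite big1 // => i _; apply/eqP; rewrite trop_mul_eq0.
apply: contraT; rewrite negb_or => /andP[ai Aij].
have [t ti tE] := minor_attained B ord0 i.
have tk k : k != i -> B k (t k) != 0.
  move=> ki; apply: contraNneq ai => Bk.
  by rewrite -nu_eq0 nu_tangible_part tE (bigD1 k) //= Bk mul0r.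
pose g k := if unlift ord0 (t k) is Some q then f q else j.
have g_inj : injective g.
  move=> k l; rewrite /g.
  case: unliftP => [q tkE|tkE]; case: unliftP => [r tlE|tlE].
  - by move/f_inj => qr; apply: (@perm_inj _ t); rewrite tkE tlE qr.
  - by move=> fq; move: (fj q); rewrite fq eqxx.
  - by move=> fr; move: (fj r); rewrite fr eqxx.
  - by move=> _; apply: (@perm_inj _ t); rewrite tkE tlE.
have [k] := noT g g_inj; rewrite /g; case: unliftP => [q tkE|tkE].
  have ki : k != i.
    by apply: contra_eqN tkE => /eqP ->; rewrite ti; apply: neq_lift.
  by move=> Ak; move: (tk k ki); rewrite tkE BS Ak eqxx.
have /perm_inj -> : t k = t i by rewrite tkE ti.
by move=> A0; rewrite A0 eqxx in Aij.
Qed.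

Lemma singular_dependent (n : nat) (A : 'M[trop R]_n) :
  trop_singular A -> trop_dependent (fun i => row i A).
Proof.
move=> sing; have [d0|] := eqVneq (trop_det A) 0; last first.
  exact: singular_dependent_pos.
apply: no_transversal_dependent => f f_inj; apply: contrapT => h.
have : \prod_i A i (perm f_inj i) != 0.
  rewrite prod_neq0; apply/forallP => i; rewrite permE.
  by apply/eqP => Ai; apply: h; exists i.
have := @nu_sum _ _ xpredT (fun s : 'S_n => \prod_k A k (s k)) (perm f_inj) isT.
by rewrite -/(trop_det A) d0 nu_leE eqxx orbF => /eqP -> /eqP.
Qed.

End SingularDependent.

(** * Potentials on a digraph without positive cycles *)

Section Potentials.
Variables (R : realDomainType) (I : finType) (e : rel I) (w : I -> I -> R).

Fixpoint weight x s := if s is y :: s' then w x y + weight y s' else 0.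

Lemma weight_cat x s1 s2 :
  weight x (s1 ++ s2) = weight x s1 + weight (last x s1) s2.
Proof. by elim: s1 x => [|y s IH] x /=; rewrite ?add0r // IH addrA. Qed.

Lemma weight_rcons x s y : weight x (rcons s y) = weight x s + w (last x s) y.
Proof. by rewrite -cats1 weight_cat /= addr0. Qed.

Lemma weight_next x s : uniq (x :: s) ->
  \sum_(y <- x :: s) w y (next (x :: s) y) = weight x (rcons s x).
Proof.
(* For the induction, the vertex [z] closing the cycle is separated from its head [x]. *)
suff: forall z, uniq (x :: s) ->
    \sum_(y <- x :: s) w y (next_at y z x s) = weight x (rcons s z) by apply.
elim: s x => [|y s IH] x z /=; first by rewrite big_seq1 eqxx addr0.
move=> /andP[xys Us]; rewrite big_cons eqxx -IH //; congr (_ + _).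
by apply: eq_big_seq => k ks; case: eqP => // kx; rewrite -kx ks in xys.
Qed.

(* [u j] is the largest weight of a simple path ending at [j]. *)
Lemma cycle_potential :
  (forall x s, uniq (x :: s) -> path e x (rcons s x) ->
     weight x (rcons s x) <= 0) ->
  exists u : I -> R, forall i j, e i j -> u i + w i j <= u j.
Proof.
move=> cyc.
(* A bound on the length makes the candidates a finite type, so a maximum exists; simple paths
   respect it. *)
pose ends j (p : I * #|I|.-bseq I) :=
  [&& uniq (p.1 :: p.2), path e p.1 p.2 & last p.1 p.2 == j].
have max j : exists u : R,
    (exists x s,
       [/\ uniq (x :: s), path e x s, last x s = j & weight x s = u]) /\
    (forall x s,
       uniq (x :: s) -> path e x s -> last x s = j -> weight x s <= u).
  have e0 : ends j (j, [bseq]) by rewrite /ends /= eqxx.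
  have [[x s] /and3P[/= U E /eqP L] max] :=
    arg_maxP (fun p : I * #|I|.-bseq I => weight p.1 p.2) e0.
  exists (weight x s); split=> [|y t Ut Et Lt]; first by exists x, s.
  have st : (size t <= #|I|)%N.
    have /card_uniqP yt : uniq (y :: t) by [].
    by rewrite ltnW // -[(size t).+1]/(size (y :: t)) -yt max_card.
  by apply: (max (y, Bseq st)); rewrite /ends /= -Lt eqxx andbT; apply/andP.
case: (choice max) => u uP; exists u => i j eij.
have [[x [s [U E L <-]]] _] := uP i; have [_ ub] := uP j.
have [js|js] := boolP (j \in x :: s); last first.
  rewrite -L -weight_rcons; apply: ub; last by rewrite last_rcons.
    by rewrite -rcons_cons rcons_uniq js U.
  by rewrite rcons_path E L.
(* Here [j] is already on the path: the part after [j] closes up to a cycle of weight at most 0, and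
   the part before is a simple path to [j]. *)
case/splitPl: js U E L => p1 p2 L1.
rewrite -cat_cons cat_uniq => /and3P[U1 D U2]; rewrite cat_path last_cat L1.
move=> /andP[E1 E2] L2.
rewrite weight_cat -addrA L1 -L2 -weight_rcons.
have := ub x p1 U1 E1 L1; have : weight j (rcons p2 j) <= 0; last by lra.
apply: cyc; last by rewrite rcons_path E2 L2.
rewrite /= U2 andbT; apply: contra D => jp2; apply/hasP; exists j => //.
by rewrite -L1 mem_last.
Qed.

(** The map [next] along a simple cycle, extended by the identity, is a permutation moving exactly
    the vertices of the cycle; irreflexivity excludes loops. *)
Lemma perm_potential : irreflexive e ->
  (forall s : {perm I}, (forall i, s i != i -> e i (s i)) ->
     \sum_(i | s i != i) w i (s i) <= 0) ->
  exists u : I -> R, forall i j, e i j -> u i + w i j <= u j.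
Proof.
move=> eirr perm_le0; apply: cycle_potential => x s U E.
pose f := perm (can_inj (prev_next U)).
have fc i : (f i != i) = (i \in x :: s).
  rewrite permE; apply/idP/idP; last first.
    move=> ic; have eic := @next_cycle _ e (x :: s) i E ic.
    by apply: contraTneq eic => ->; rewrite eirr.
  by apply: contraR => ic; rewrite next_nth (negPf ic).
rewrite -weight_next // big_uniq //.
rewrite (eq_big (fun i => f i != i) (fun i => w i (f i))).
- apply: perm_le0 => i; rewrite fc permE => ic.
  by apply: (@next_cycle _ e (x :: s)).
- by move=> i; rewrite fc.
- by move=> i _; rewrite permE.
Qed.

End Potentials.

(** * Rescaling nonsingular matrices, and pseudo inverses *)

Section PseudoInverse.
Variable R : realFieldType.

Lemma finite_pos_lower_bound (I : finType) (P : pred I) (F : I -> R) :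
  (forall i, P i -> 0 < F i) ->
  exists2 d, 0 < d & forall i, P i -> d <= F i.
Proof.
(* The default 1 keeps the bound positive when [P] is empty. *)
move=> F_gt0; exists (\big[Num.min/1]_(i | P i) F i).
  by elim/big_ind: _ => // x y x0 y0; rewrite lt_min x0.
by move=> i Pi; apply: bigmin_le_cond.
Qed.

Lemma nonsingular_potential (n : nat) (A : 'M[trop R]_n) :
  trop_nonsingular A ->
  exists (s : 'S_n) (t u : 'I_n -> R) (d : R),
    [/\ 0 < d, forall k, A k (s k) = Tangible (t k) &
      forall i k, i != k -> A i (s k) != 0 ->
        mag (A i (s k)) + u i + d <= t k + u k].
Proof.
move=> reg; pose p (s : 'S_n) := \prod_k A k (s k).
(* Otherwise every tangible term of the determinant would be dominated, making it ghost or -oo. *)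
have [s [sT smax]] : exists s, ~~ in_Ubar (p s) /\
    forall s', s' != s -> p s' != 0 -> mag (p s') < mag (p s).
  apply: contrapT => h; apply: reg; apply/sum_tangibleP => s sT.
  apply: contrapT => h'; apply: h; exists s; split=> // s' ss' ps'.
  rewrite ltNge; apply/negP => le; apply: h'; exists s' => //.
  by rewrite nu_leE ps' le orbT.
have tE k : A k (s k) = Tangible (mag (A k (s k))).
  by move: sT; rewrite prod_tangible => /forallP/(_ k); case: (A k (s k)).
pose t k := mag (A k (s k)).
have As k : A k (s k) != 0 by rewrite tE trop_eqE.
have [g g0 gap] := @finite_pos_lower_bound _
  (fun s' => (s' != s) && (p s' != 0)) (fun s' => mag (p s) - mag (p s'))
  (fun s' (h : (s' != s) && (p s' != 0)) =>
     ltac:(by rewrite subr_gt0; case/andP: h; apply: smax)).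
(* A permutation collects the bonus [d] at most [n] times, hence at most the gap [g]; the successor
   also covers [n = 0]. *)
pose d := g / n.+1%:R.
have d0 : 0 < d by rewrite divr_gt0 ?ltr0Sn.
have [||u uP] := @perm_potential R _ (fun i k => (i != k) && (A i (s k) != 0))
    (fun i k => mag (A i (s k)) - t k + d).
- by move=> i /=; rewrite eqxx.
- move=> f fE /=.
  have [->|f1] := eqVneq f 1%g.
    by rewrite big_pred0 // => i; rewrite perm1 eqxx.
  pose s' := (f * s)%g.
  have s's : s' != s by rewrite -[s]mul1g (inj_eq (mulIg s)).
  have As' i : A i (s' i) != 0.
    rewrite /s' permM; have [->//|fi] := eqVneq (f i) i.
    by have /andP[] := fE i fi.
  have ps' : p s' != 0 by rewrite prod_neq0; apply/forallP.
  have := gap s'; rewrite s's ps' => /(_ isT).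
  rewrite /p !mag_prod // => gap'.
  (* Fixed points can be included, as each contributes only [d]. *)
  apply: (@le_trans _ _ (\sum_i (mag (A i (s' i)) - t (f i) + d))).
    rewrite big_mkcond; apply: ler_sum => i _; rewrite /s' permM.
    by have [->|//] := eqVneq (f i) i; rewrite /= /t subrr add0r ltW.
  rewrite big_split sumrB sumr_const card_ord /=.
  have -> : \sum_i t (f i) = \sum_i t i.
    by rewrite [RHS](reindex_inj (@perm_inj _ f)).
  have : d *+ n <= g.
    by rewrite -mulr_natr mulrAC ler_pdivrMr ?ltr0Sn // ler_pM2l // ler_nat.
  by rewrite /t; lra.
exists s, t, u, d; split=> // i k ik Aik.
by have := uP i k; rewrite ik Aik => /(_ isT); lra.
Qed.

(** If [i] maximises [mag (alpha i) - u i] among the coefficients other than -oo, then in column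
    [s i] its tangible term strictly exceeds every other term, by the potential inequality. *)
Lemma dependent_singular (n : nat) (A : 'M[trop R]_n) :
  trop_dependent (fun i => row i A) -> trop_singular A.
Proof.
move=> /rows_dependentE[alpha [tA [i0 nz] col]].
apply: contrapT => /nonsingular_potential[s [t [u [d [d0 tE uP]]]]].
have [i ai max] := 
  @arg_maxP _ _ _ i0 (fun i => alpha i != 0) (fun i => mag (alpha i) - u i) nz.
have [|j ji] := (sum_tangibleP _).1 (col (s i)) i.
  by rewrite tE; move: (tA i) ai; case: (alpha i).
have A0 : A i (s i) != 0 by rewrite tE trop_eqE.
rewrite nu_leE !trop_mul_eq0 (negPf ai) (negPf A0) /= negb_or tE.
move=> /andP[/andP[aj Aj]].
have := uP j i ji Aj; have /= := max j aj.
move: ai aj Aj; case: (alpha i) => [|x|x] //; case: (alpha j) => [|y|y] //;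
  case: (A j (s i)) => [|z|z] //= _ _ _; lra.
Qed.

Lemma trop_add_ghost_absorb (y : trop R) c :
  (y != 0 -> mag y <= c) -> y + Ghost c = Ghost c.
Proof.
rewrite trop_plusE trop_addE; case: y => [//|a|a] /(_ isT) /= h.
  by rewrite h.
by case: ltP => // h'; congr Ghost; lra.
Qed.

Lemma trop_add_tangible_absorb (y : trop R) c :
  (y != 0 -> mag y < c) -> y + Tangible c = Tangible c.
Proof.
rewrite trop_plusE trop_addE.
case: y => [//|a|a] /(_ isT) /= h; last by rewrite h.
by rewrite lt_eqF // h.
Qed.

(** [M] is a diagonal conjugate of the matrix with diagonal 0 and [Ghost (- d)] elsewhere. In a
    permutation product the [x] cancel and each moved point costs [d], so the identity is the only
    optimum. *)
Lemma diagonal_conj_pseudo_unit (n : nat) (x : 'I_n -> R) (d : R)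
    (M : 'M[trop R]_n) :
  0 < d ->
  (forall i j, M i j = if i == j then Tangible 0 else Ghost (x j - x i - d)) ->
  pseudo_unit M.
Proof.
move=> d0 ME; split; last 2 first.
- by move=> i; rewrite ME eqxx.
- by move=> i j ij; rewrite ME (negPf ij).
move=> sing.
have [|s s1] := (sum_tangibleP _).1 sing 1%g.
  by rewrite prod_tangible; apply/forallP => i; rewrite perm1 ME eqxx.
have M0 i j : M i j != 0 by rewrite ME; case: ifP; rewrite trop_eqE.
have p0 (f : 'S_n) : \prod_i M i (f i) != 0 by rewrite prod_neq0; apply/forallP.
rewrite nu_leE (negPf (p0 _)) p0 /= !mag_prod // big1 => [|i _]; last first.
  by rewrite perm1 ME eqxx.
rewrite (eq_bigr (fun i =>
  x (s i) - x i - (if i == s i then 0 else d))); last first.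
  by move=> i _; rewrite ME; case: eqP => [<-|] //=; rewrite subrr subr0.
rewrite !sumrB [X in _ <= _ - X - _](reindex_inj (@perm_inj _ s)).
rewrite subrr add0r oppr_ge0.
have /existsP[i si] : [exists i, s i != i].
  apply: contraNT s1 => /existsPn h; apply/eqP/permP => i.
  by rewrite perm1; apply/eqP; have := h i; rewrite negbK.
rewrite leNgt (bigD1 i) //= eq_sym (negPf si) ltr_pwDl // sumr_ge0 // => j _.
by case: ifP => // _; apply: ltW.
Qed.

Lemma nonsingular_pseudo_invertible (n : nat) (A : 'M[trop R]_n) :
  trop_nonsingular A -> pseudo_invertible A.
Proof.
move=> /nonsingular_potential[s [t [u [d [d0 tE uP]]]]].
(* The pseudo inverse of the rescaled matrix, with the scalings [u] and [t + u] and the permutation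
   [s] undone. *)
pose B : 'M[trop R]_n := \matrix_(j, l)
  let k := (s^-1)%g j in
  if k == l then Tangible (- t k) else Ghost (u l - u k - t k - d).
have BE k l : B (s k) l =
    if k == l then Tangible (- t k) else Ghost (u l - u k - t k - d).
  by rewrite mxE /= permK.
exists B; split.
  apply: (@diagonal_conj_pseudo_unit _ u d) => // i l.
  rewrite mxE (reindex_inj (@perm_inj _ s)) /=.
  have Ei : A i (s i) * B (s i) l =
      if i == l then Tangible 0 else Ghost (u l - u i - d).
    rewrite tE BE; case: eqP => _; rewrite trop_multE /=.
      by rewrite subrr.
    by congr Ghost; lra.
  (* The term of index [i] is the whole sum: on the diagonal the others are strictly smaller, and
     off it a tangible one may tie, but a ghost absorbs it. *)
  rewrite -Ei; apply: sum_absorb => k ki; rewrite Ei BE.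
  have := uP i k; rewrite eq_sym ki => /(_ isT).
  case: (eqVneq i l) => [<-|il]; rewrite ?(negPf ki).
    move=> h; apply: trop_add_tangible_absorb => nz; move: nz h.
    case: (A i (s k)) => [|a|a] //= _ /(_ isT); lra.
  move=> h; apply: trop_add_ghost_absorb; move: h.
  case: (eqVneq k l) => [<-|kl].
    case: (A i (s k)) => [|a|a] //= /(_ isT); lra.
  case: (A i (s k)) => [|a|a] //= /(_ isT); lra.
(* In the other product the conjugating scaling is [u + t], carried along [s]. *)
apply: (@diagonal_conj_pseudo_unit _
  (fun j => u ((s^-1)%g j) + t ((s^-1)%g j)) d) => //.
move=> j j'; rewrite -[j](permKV s) -[j'](permKV s).
rewrite (inj_eq (@perm_inj _ s)) !permK.
move: ((s^-1)%g j) ((s^-1)%g j') => k l.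
have El : B (s k) l * A l (s l) =
    if k == l then Tangible 0 else Ghost (u l + t l - (u k + t k) - d).
  rewrite tE BE; case: eqP => [->|_]; rewrite trop_multE /=.
    by rewrite addrC subrr.
  by congr Ghost; lra.
rewrite mxE -El; apply: sum_absorb => i il; rewrite El BE.
have := uP i l il.
case: (eqVneq k l) => [->|kl].
  rewrite [l == i]eq_sym (negPf il) => h.
  apply: trop_add_tangible_absorb => nz; move: nz h.
  case: (A i (s l)) => [|a|a] //= _ /(_ isT); lra.
move=> h; apply: trop_add_ghost_absorb; move: h.
case: (eqVneq k i) => [->|ki].
  case: (A i (s l)) => [|a|a] //= /(_ isT); lra.
case: (A i (s l)) => [|a|a] //= /(_ isT); lra.
Qed.

(** Ghosts and -oo form an ideal, so a combination of rows that lands in it still does so after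
    multiplication by [B]. *)
Lemma pseudo_invertible_nonsingular (n : nat) (A : 'M[trop R]_n) :
  pseudo_invertible A -> trop_nonsingular A.
Proof.
move=> [B [[AB_reg _ _] _]] /singular_dependent/rows_dependentE.
move=> [alpha [tA nz col]].
apply: AB_reg; apply/dependent_singular/rows_dependentE.
exists alpha; split=> // j.
have -> : \sum_i alpha i * (A *m B) i j =
    \sum_k (\sum_i alpha i * A i k) * B k j.
  under eq_bigr => i _ do rewrite mxE big_distrr.
  rewrite exchange_big; apply: eq_bigr => k _; rewrite big_distrl.
  by apply: eq_bigr => i _; rewrite /= mulrA.
by apply: in_Ubar_sum => k; apply/in_UbarMr/col.
Qed.

End PseudoInverse.

(** * Full rank as independence of all rows *)

Lemma independent_setT (R : realDomainType) (I : finType) (n : nat)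
    (v : I -> 'rV[trop R]_n) :
  trop_independent (fun i : {i : I | i \in [set: I]} => v (val i)) <->
  trop_independent v.
Proof.
have sumE (alpha : I -> trop R) :
    \sum_(i : {i : I | i \in [set: I]}) alpha (val i) *: v (val i) =
    \sum_i alpha i *: v i.
  rewrite -(big_sub _ (fun i => alpha i *: v i)).
  by apply: eq_bigl => i; rewrite inE.
split=> ind [alpha [tA [i0 nz] col]]; apply: ind.
  exists (fun i => alpha (val i)); split=> // [|j]; last by rewrite sumE.
  by exists (exist _ i0 (in_setT i0)).
exists (fun i => alpha (exist _ i (in_setT i))); split=> // [|j].
  by exists (val i0); move: nz; congr (alpha _ != _); apply: val_inj.
rewrite -sumE; move: (col j); congr (in_Ubar (fun_of_matrix _ _ _)).
by apply: eq_bigr => i _; congr (alpha _ *: _); apply: val_inj.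
Qed.

Lemma rank_fullP (R : realDomainType) (n : nat) (A : 'M[trop R]_n) :
  trop_rank A = n <-> trop_independent (fun i => row i A).
Proof.
pose P (S : {set 'I_n}) :=
  `[< trop_independent (fun i : {i : 'I_n | i \in S} => row (val i) A) >].
split=> [rk|ind].
  (* The empty family is independent, so the maximum ranges over a nonempty collection and is
     attained. *)
  have P0 : P set0.
    by apply/asboolP => -[alpha [_ [[i i0] _] _]]; have := i0; rewrite inE.
  have [S /asboolP PS cS] := eq_bigmax_cond (fun S : {set 'I_n} => #|S|)
    (introT card_gt0P (ex_intro (fun S => S \in P) set0 P0)).
  have rkS : trop_rank A = #|S| := cS.
  apply/(independent_setT (fun i => row i A)).
  have -> // : [set: 'I_n] = S.
  by apply/esym/eqP; rewrite eqEcard subsetT cardsT card_ord -rkS rk leqnn.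
apply/eqP; rewrite eqn_leq; apply/andP; split.
  by apply/bigmax_leqP => S _; rewrite -[X in (_ <= X)%N](card_ord n) max_card.
rewrite -[X in (X <= _)%N](card_ord n) -cardsT.
apply: (leq_bigmax_cond (P := P)).
by apply/asboolP/(independent_setT (fun i => row i A)).
Qed.

Theorem corollary3p7 (R : realType) (n : nat) (A : 'M[trop R]_n) :
  (trop_rank A = n <-> trop_nonsingular A) /\
  (trop_nonsingular A <-> pseudo_invertible A).
Proof.
split; last first.
  split; first exact: nonsingular_pseudo_invertible.
  exact: pseudo_invertible_nonsingular.
apply: iff_trans (rank_fullP A) _.
split=> h; first by move=> /singular_dependent/h.
by move=> /dependent_singular/h.
Qed.
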